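(* Let $m,r$ be integers with $0<r\le\lfloor m/2\rfloor$. Let $C_1=RM^\ast(r,m)$ and let $C_2$ be the binary linear code determined by $C_2^\perp=\mathrm{even}(RM^\ast(r,m))\subset C_1$. Put $n=2^m-1$ and $\Delta=2^{\lfloor m/r\rfloor-1}$. Then $CSS(C_1,C_2)$ is an $[[n,1,d]]$ code with $d=\min(2^{m-r}-1,\,2^{r+1}-1)$, and it has the transversal gate $G=\bigotimes_{j=1}^n\mathrm{diag}(1,e^{i2\pi/\Delta})$, which enacts the encoded gate $\bar G=\mathrm{diag}(1,e^{-i2\pi/\Delta})\in\mathcal C^{(1)}_{\log_2\Delta}$ on the logical qubit.
   Context: $RM(r,m)$ is the $r$-th order binary Reed–Muller code of length $2^m$; $RM^\ast(r,m)$ is the punctured code of length $2^m-1$ obtained by deleting one coordinate; $\mathrm{even}(C)$ is the subcode of even-weight words of $C$. For binary linear codes of length $n$ with $C_2^\perp\subset C_1$, $CSS(C_1,C_2)$ is the $n$-qubit stabilizer code with orthogonal basis $|\tilde a\rangle\propto\sum_{c\in C_2^\perp}|a+c\rangle$, $a\in C_1/C_2^\perp$. Its stabilizer $\mathcal S$ is generated by the Pauli operators $\bigotimes_i X^{c_i}$, $c\in C_2^\perp$, and $\bigotimes_i Z^{c_i}$, $c\in C_1^\perp$. Here $C_1/C_2^\perp$ has two elements, with logical basis states $|\bar 0\rangle=|\tilde 0\rangle$ and $|\bar 1\rangle=|\tilde a\rangle$ for the nontrivial coset (that of the all-ones word). A stabilizer code is $[[n,k,d]]$ if it has $n$ qubits,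 dimension $2^k$, and $d$ is the minimum weight (number of non-identity tensor factors) of a Pauli operator that commutes with all of $\mathcal S$ but is not (up to phase) in $\mathcal S$. A gate $G$ that is a tensor product of single-qubit unitaries is transversal if it maps the code space to itself; it enacts $\bar G$ if it acts on the code space as $\bar G$ in the basis $|\bar0\rangle,|\bar1\rangle$. The sets $\mathcal C_k^{(n)}$ are defined by: $\mathcal C_1^{(n)}$ is the $n$-qubit Pauli group $\mathcal G_n$ (all $\alpha R_1\otimes\cdots\otimes R_n$, $\alpha\in\{\pm1,\pm i\}$, $R_i\in\{I,X,Y,Z\}$) and, for $k>1$, $\mathcal C_k^{(n)}=\{U : UgU^\dagger\in\mathcal C_{k-1}^{(n)}\ \forall g\in\mathcal C_1^{(n)}\}$, where $U$ ranges over unitary $2^n\times2^n$ matrices; global phases of gates are disregarded in membership statements. *)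

(* Defs.v *)
From HB Require Import structures.
From mathcomp Require Import all_boot all_order all_algebra.
From mathcomp Require Import reals trigo.
From mathcomp Require Import complex.

Set Implicit Arguments.
Unset Strict Implicit.
Unset Printing Implicit Defensive.

Import Order.TTheory GRing.Theory Num.Theory.
Local Open Scope ring_scope.
Local Open Scope sesquilinear_scope.

(* The i-th binary digit of j is the i-th coordinate: this labels both the
   evaluation points of Reed-Muller codes and the computational basis of the
   n-qubit space by vectors over F_2. *)
Definition bits (n : nat) (j : 'I_(2 ^ n)) : 'rV['F_2]_n :=
  \row_(i < n) (odd (j %/ 2 ^ i))%:R.

Lemma bits_bij n : bijective (@bits n).
Proof.
apply: inj_card_bij; last by rewrite card_ord card_mx card_ord mul1n.
move=> [a ha] [b hb] /rowP e; apply/val_inj => /=.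
have {}e i : (i < n)%N -> odd (a %/ 2 ^ i) = odd (b %/ 2 ^ i).
  by move=> hi; move: (e (Ordinal hi)); rewrite !mxE /=; do 2!case: odd.
elim: n a b ha hb e => [[|a] [|b] //|n IHn a b ha hb e].
have h : a./2 = b./2.
  apply: IHn => [||i hi]; try by rewrite -divn2 ltn_divLR // -expnSr.
  by move: (e i.+1 hi); rewrite -!divn2 -!divnMA -expnS.
by rewrite -(odd_double_half a) -(odd_double_half b) h;
  move: (e 0%N isT); rewrite !divn1 => ->.
Qed.

Definition code (n : nat) := {vspace 'rV['F_2]_n}.

Definition hweight n (c : 'rV['F_2]_n) : nat := #|[set i | c 0 i != 0]|.

Definition dual_code n (C : code n) : code n :=
  (\bigcap_(c : 'rV['F_2]_n | c \in C) lker (linfun (mulmxr c^T)))%VS.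

Lemma mem_dual_code n (C : code n) (x : 'rV['F_2]_n) :
  (x \in dual_code C) = [forall (c | c \in C), x *m c^T == 0].
Proof.
by rewrite memvE; apply/subv_bigcapP/forall_inP => h c /h;
  rewrite -memvE memv_ker lfunE.
Qed.

Lemma dual_codeK n (C : code n) : dual_code (dual_code C) = C.
Proof.
pose M : 'M['F_2]_(\dim C, n) := \matrix_i (vbasis C)`_i.
have memC x : (x \in C) = (x <= M)%MS.
  apply/idP/submxP => [/coord_vbasis -> | [u ->]].
    exists (\row_i coord (vbasis C) i x); rewrite mulmx_sum_row.
    by apply: eq_bigr => i _; rewrite mxE rowK.
  rewrite mulmx_sum_row; apply: memv_suml => i _; apply: memvZ.
  by rewrite rowK; apply: vbasis_mem; rewrite mem_nth ?size_tuple.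
have memD x : (x \in dual_code C) = (x *m M^T == 0).
  rewrite mem_dual_code; apply/forall_inP/eqP => [h | h c].
    apply/matrixP => a i; rewrite (ord1 a) mxE [RHS]mxE.
    have /h/eqP/matrixP/(_ 0 0) : row i M \in C by rewrite memC row_sub.
    by rewrite !mxE; apply: etrans; apply: eq_bigr => k _; rewrite !mxE.
  by rewrite memC => /submxP[u ->]; rewrite trmx_mul mulmxA h mul0mx.
apply/eqP; rewrite eqEsubv; apply/andP; split; apply/subvP => x; last first.
  move=> xC; rewrite mem_dual_code; apply/forall_inP => c.
  rewrite mem_dual_code => /forall_inP/(_ x xC)/eqP h.
  by rewrite -[x *m _]trmxK trmx_mul trmxK h trmx0.
rewrite mem_dual_code memC => /forall_inP h.
rewrite -(eqmxP (_ : kermx (kermx M^T)^T == M)%MS); last first.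
  have s : (M <= kermx (kermx M^T)^T)%MS.
    by apply/sub_kermxP/trmx_inj; rewrite trmx_mul trmxK mulmx_ker trmx0.
  rewrite andbC -(mxrank_leqif_eq s).2.
  by rewrite !mxrank_ker !mxrank_tr !mxrank_ker !mxrank_tr subKn ?rank_leq_col.
apply/sub_kermxP/matrixP => a i; rewrite (ord1 a) mxE [RHS]mxE.
have /h/eqP/matrixP/(_ 0 0) : row i (kermx M^T) \in dual_code C.
  by rewrite memD -row_mul mulmx_ker row0.
by rewrite !mxE; apply: etrans; apply: eq_bigr => k _; rewrite !mxE.
Qed.

(* Over F_2 the coordinates of c sum to 0 iff the weight of c is even. *)
Definition even_code n (C : code n) : code n :=
  (C :&: lker (linfun (mulmxr (const_mx 1 : 'cV['F_2]_n))))%VS.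

Lemma mem_even_code n (C : code n) (x : 'rV['F_2]_n) :
  (x \in even_code C) = (x \in C) && ~~ odd (hweight x).
Proof.
rewrite memv_cap memv_ker lfunE /=; congr (_ && _).
have -> : x *m (const_mx 1 : 'cV_n) = const_mx (hweight x)%:R.
  apply/matrixP => a b; rewrite !mxE /hweight -sum1_card natr_sum [RHS]big_mkcond /=.
  apply: eq_bigr => i _; rewrite !mxE mulr1 inE (ord1 a).
  by case: (x _ _) => -[|[|k]] hk //=; apply/val_inj.
have -> : (hweight x)%:R = (odd (hweight x))%:R :> 'F_2.
  by apply/val_inj; rewrite /= !Zp_nat /= !modn2; case: odd.
case: odd; last by apply/eqP/matrixP => a b; rewrite !mxE.
by apply/eqP => /matrixP/(_ 0 0); rewrite !mxE.
Qed.

Lemma even_code_sub n (C : code n) : (even_code C <= C)%VS.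
Proof. exact: capvSl. Qed.

(* The value table of the monomial \prod_(i in A) x_i on F_2^m. *)
Definition monomial_word m (A : {set 'I_m}) : 'rV['F_2]_(2 ^ m) :=
  \row_(j < 2 ^ m) \prod_(i in A) bits j 0 i.

Definition RM (r m : nat) : code (2 ^ m) :=
  <<[seq monomial_word A | A in [set A : {set 'I_m} | (#|A| <= r)%N]]>>%VS.

(* The deleted coordinate p is arbitrary. *)
Definition puncturedRM (r m : nat) (p : 'I_(2 ^ m)) : code (2 ^ m).-1 :=
  (linfun (col' p) @: RM r m)%VS.

Section Qubits.
Variable C : numClosedFieldType.

Definition mx2 (a b c d : C) : 'M[C]_2 :=
  \matrix_(i < 2, j < 2)
    if i == 0 then (if j == 0 then a else b) else (if j == 0 then c else d).

(* A_0 (x) ... (x) A_(n-1); 'F_2 and 'I_2 are the same type. *)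
Definition tens n (A : 'I_n -> 'M[C]_2) : 'M[C]_(2 ^ n) :=
  \matrix_(i, j) \prod_(k < n) A k (bits i 0 k) (bits j 0 k).

Definition ket n (x : 'rV['F_2]_n) : 'cV[C]_(2 ^ n) :=
  \col_i (bits i == x)%:R.

Inductive pauli := PI | PX | PY | PZ.

Definition pauli_mx (P : pauli) : 'M[C]_2 :=
  match P with
  | PI => mx2 1 0 0 1
  | PX => mx2 0 1 1 0
  | PY => mx2 0 (- 'i) 'i 0
  | PZ => mx2 1 0 0 (-1)
  end.

Definition is_PI (P : pauli) : bool := if P is PI then true else false.

Definition pauli_op n (P : 'I_n -> pauli) : 'M[C]_(2 ^ n) :=
  tens (fun i => pauli_mx (P i)).

Definition pauli_weight n (P : 'I_n -> pauli) : nat :=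
  #|[set i | ~~ is_PI (P i)]|.

Definition pauli_group n (U : 'M[C]_(2 ^ n)) : Prop :=
  exists (a : C) (P : 'I_n -> pauli),
    a \in [:: 1; -1; 'i; - 'i] /\ U = a *: pauli_op P.

(* The level k = 0 is not used; it is empty by convention. *)
Fixpoint hierarchy (k n : nat) (U : 'M[C]_(2 ^ n)) : Prop :=
  match k with
  | 0 => False
  | k'.+1 =>
    if k' == 0%N then pauli_group U
    else U \is unitarymx /\
         forall g : 'M[C]_(2 ^ n), pauli_group g -> hierarchy k' (U *m g *m U^t*)
  end.

Definition hierarchy_mod_phase (k n : nat) (U : 'M[C]_(2 ^ n)) : Prop :=
  exists a : C, `|a| = 1 /\ hierarchy k (a *: U).

Inductive generated_group N (D : 'M[C]_N -> Prop) : 'M[C]_N -> Prop :=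
  | gen_in A of D A : generated_group D A
  | gen_one : generated_group D 1%:M
  | gen_mul A B of generated_group D A & generated_group D B :
      generated_group D (A *m B)
  | gen_inv A of generated_group D A : generated_group D (invmx A).

Definition pauli_on n (P : pauli) (c : 'rV['F_2]_n) : 'M[C]_(2 ^ n) :=
  pauli_op (fun i => if c 0 i == 1 then P else PI).

Definition css_generator n (C1 C2 : code n) (A : 'M[C]_(2 ^ n)) : Prop :=
  (exists2 c, c \in dual_code C2 & A = pauli_on PX c) \/
  (exists2 c, c \in dual_code C1 & A = pauli_on PZ c).

Definition css_stabilizer n (C1 C2 : code n) : 'M[C]_(2 ^ n) -> Prop :=
  generated_group (css_generator C1 C2).

Definition css_ket n (C2 : code n) (a : 'rV['F_2]_n) : 'cV[C]_(2 ^ n) :=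
  (sqrtC #|dual_code C2|%:R)^-1 *: \sum_(c in dual_code C2) ket (a + c).

Definition css_space n (C1 C2 : code n) : {vspace 'cV[C]_(2 ^ n)} :=
  <<[seq css_ket C2 a | a in C1]>>%VS.

Definition nontrivial_logical n (S : 'M[C]_(2 ^ n) -> Prop) (P : 'I_n -> pauli) :=
  (forall s, S s -> pauli_op P *m s = s *m pauli_op P) /\
  ~ (exists a : C, `|a| = 1 /\ S (a *: pauli_op P)).

(* The code space Q with stabilizer S is an [[n,k,d]] code. *)
Definition stabilizer_code n (Q : {vspace 'cV[C]_(2 ^ n)})
    (S : 'M[C]_(2 ^ n) -> Prop) (k d : nat) : Prop :=
  [/\ forall v, v \in Q <-> (forall s, S s -> s *m v = v),
      \dim Q = (2 ^ k)%N,
      exists2 P : 'I_n -> pauli, nontrivial_logical S P & pauli_weight P = d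
    & forall P : 'I_n -> pauli, nontrivial_logical S P -> (d <= pauli_weight P)%N].

Definition transversal_gate n (Q : {vspace 'cV[C]_(2 ^ n)}) (G : 'M[C]_(2 ^ n)) :=
  (exists A : 'I_n -> 'M[C]_2, (forall j, A j \is unitarymx) /\ G = tens A) /\
  (forall v, v \in Q -> G *m v \in Q).

Definition enacts n (Q : {vspace 'cV[C]_(2 ^ n)}) (v0 v1 : 'cV[C]_(2 ^ n))
    (G : 'M[C]_(2 ^ n)) (Gbar : 'M[C]_2) : Prop :=
  [/\ basis_of Q [:: v0; v1],
      G *m v0 = Gbar 0 0 *: v0 + Gbar 1 0 *: v1
    & G *m v1 = Gbar 0 1 *: v0 + Gbar 1 1 *: v1].

End Qubits.

Definition cexpi (R : realType) (t : R) : R[i] := (cos t +i* sin t)%C.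

(* diag(1, e^{it}) *)
Definition phase_gate (R : realType) (t : R) : 'M[R[i]]_2 :=
  mx2 1 0 0 (cexpi t).

(* Main.v *)
Require Import Defs.
From mathcomp Require Import all_boot all_order all_algebra.
From mathcomp Require Import reals trigo.
From mathcomp Require Import complex.
From mathcomp Require Import ring.

Set Implicit Arguments.
Unset Strict Implicit.
Unset Printing Implicit Defensive.

Import Order.TTheory GRing.Theory Num.Theory.
Local Open Scope ring_scope.

(* Write E for the even words of C1 = RM*(r,m). As n is odd and C1 contains the
   all-ones word, C1 = E + {0,1}; so a vector is fixed by the stabilizer iff, as a
   function on F_2^n, it is E-periodic and supported on C1, and the code space is
   spanned by |0~> and |1~>. A Pauli operator with X-part a and Z-part b commutes
   with the stabilizer iff a is in C1 and b in the dual of E, and is non-trivial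
   iff moreover a or b has odd weight. Restoring the deleted coordinate, an odd a becomes a
   nonzero word of RM(r,m), and an odd b a nonzero word of the dual of RM(r,m);
   both minimum distances follow from the fact that a nonempty set of fewer than
   2^(s+1) points meets some subcube of codimension at most s in a single point.

   The gate multiplies |x> by the wt(x)-th power of a Delta-th root of unity. By
   Ax's divisibility theorem weights in RM(r,m) are divisible by Delta, hence
   weights in C1 are 0 or -1 modulo Delta according to the restored coordinate. *)

(** * Arithmetic over F_2, weights and inner products *)

Lemma F2E (x : 'F_2) : x = (x != 0)%:R.
Proof. by case: x => -[|[|k]] hk //=; apply/val_inj. Qed.

Lemma F2_natr n : n%:R = (odd n)%:R :> 'F_2.
Proof. by apply/val_inj; rewrite /= !Zp_nat /= !modn2; case: odd. Qed.

Lemma F2_addxx (x : 'F_2) : x + x = 0.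
Proof. by rewrite -mulr2n -mulr_natr F2_natr mulr0. Qed.

Lemma F2mx_addxx m n (x : 'M['F_2]_(m, n)) : x + x = 0.
Proof. by apply/matrixP => i j; rewrite !mxE F2_addxx. Qed.

(** Coefficients in F_2 are 0 or 1, so every combination is a plain sum of generators. The predicate
    [K] (adding [w] preserves [P]) is stable under addition, which lets [big_ind] run over that
    sum. *)
Lemma span_F2_ind (V : vectType 'F_2) (X : seq V) (P : V -> Prop) :
  P 0 -> (forall x v, x \in X -> P v -> P (x + v)) ->
  forall v, v \in <<X>>%VS -> P v.
Proof.
move=> P0 PD v /(@coord_span _ _ _ (in_tuple X)) ->.
pose K w := forall u, P u -> P (w + u).
suff /(_ 0 P0) : K (\sum_i coord (in_tuple X) i v *: (in_tuple X)`_i) by rewrite addr0.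
apply: (big_ind K) => [u Pu|x y hx hy u Pu|i _ u Pu]; first by rewrite add0r.
  by rewrite -addrA; apply/hx/hy.
rewrite (F2E (coord _ _ _)); case: eqP => _; first by rewrite scale0r add0r.
by rewrite scale1r; apply: PD => //; apply: mem_nth.
Qed.

Lemma hweightE n (c : 'rV['F_2]_n) : hweight c = (\sum_i (c 0%R i != 0%R))%N.
Proof. by rewrite /hweight -sum1dep_card big_mkcond. Qed.

Lemma row_dotE n (x y : 'rV['F_2]_n) : (x *m y^T) 0 0 = \sum_i x 0 i * y 0 i.
Proof. by rewrite mxE; apply: eq_bigr => i _; rewrite mxE. Qed.

Lemma row_dot0 n (x y : 'rV['F_2]_n) : (x *m y^T == 0) = ((x *m y^T) 0 0 == 0).
Proof.
apply/eqP/eqP => [-> | h]; first by rewrite mxE.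
by apply/matrixP => i j; rewrite !ord1 h mxE.
Qed.

Lemma row_dot_const1 n (x : 'rV['F_2]_n) :
  (x *m (const_mx 1 : 'rV_n)^T) 0 0 = (odd (hweight x))%:R.
Proof.
rewrite row_dotE hweightE -F2_natr natr_sum.
by apply: eq_bigr => i _; rewrite mxE mulr1 -F2E.
Qed.

(** * Subcubes, and distances and weight divisibility of Reed-Muller codes *)

Section ReedMuller.
Variable m : nat.
Implicit Types (A B : {set 'I_m}) (z : 'rV['F_2]_m) (j : 'I_(2 ^ m)).

(** The coordinates in [A] are frozen to those of [z], so the subcube has codimension [#|A|]. *)
Definition in_cube A z j := [forall i in A, bits j 0 i == z 0 i].

Definition cube_word A z : 'rV['F_2]_(2 ^ m) := \row_j (in_cube A z j)%:R.

(** Each coordinate allows one bit inside [A] and two outside; distributing the product of these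
    counts gives a sum over all points, each contributing 1 or 0. *)
Lemma card_cube A z : #|[set j | in_cube A z j]| = (2 ^ (m - #|A|))%N.
Proof.
have -> : (m - #|A| = #|~: A|)%N by rewrite [RHS]cardsCs setCK card_ord.
rewrite -sum1dep_card big_mkcond /= -sum1_card expn_sum [RHS]big_mkcond /=.
pose F (i : 'I_m) (b : 'F_2) : nat := (i \in A) ==> (b == z 0 i).
transitivity (\prod_i \sum_b F i b)%N; last first.
  apply: eq_bigr => i _; rewrite inE /F; case: (i \in A) => /=.
    by rewrite (bigD1 (z 0 i)) //= eqxx big1 // => b /negPf ->.
  by rewrite sum_nat_const card_ord.
rewrite bigA_distr_bigA /=.
rewrite [RHS](reindex (fun j => [ffun i => bits j 0 i])) /=; last first.
  have [g gK Kg] := bits_bij m.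
  exists (fun f : {ffun 'I_m -> 'F_2} => g (\row_i f i)) => [j _|f _].
    by rewrite -[RHS]gK; congr g; apply/rowP => i; rewrite !mxE ffunE mxE.
  by apply/ffunP => i; rewrite ffunE Kg mxE.
apply: eq_bigr => j _; rewrite /in_cube; case: forall_inP => h.
  by rewrite big1 // => i _; rewrite /F ffunE; case: (boolP (i \in A)) => // /h ->.
case: (pickP [pred i in A | bits j 0 i != z 0 i]) => [i /andP[iA hi] | hh].
  by rewrite (bigD1 i) //= /F ffunE iA (negPf hi).
by case: h => i iA; have := hh i; rewrite /= iA /= => /negbFE.
Qed.

Lemma hweight_cube A z : hweight (cube_word A z) = (2 ^ (m - #|A|))%N.
Proof.
rewrite -(card_cube A z); apply: eq_card => j; rewrite !inE mxE.
by case: in_cube.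
Qed.

Lemma in_cubeU A B z j : in_cube (A :|: B) z j = in_cube A z j && in_cube B z j.
Proof.
apply/forall_inP/andP => [h | [/forall_inP hA /forall_inP hB] i].
  by split; apply/forall_inP => i hi; apply: h; rewrite inE hi ?orbT.
by rewrite inE => /orP[/hA | /hB].
Qed.

Lemma monomial_wordE A : monomial_word A = cube_word A (const_mx 1).
Proof.
apply/rowP => j; rewrite !mxE /in_cube; case: forall_inP => h.
  by rewrite big1 // => i /h /eqP ->; rewrite mxE.
case: (pickP [pred i in A | bits j 0 i == 0]) => [i /andP[iA /eqP hi] | hh].
  by rewrite (bigD1 i) //= hi mul0r.
case: h => i iA; have := hh i; rewrite /= iA /= => hi.
by rewrite (F2E (bits j 0 i)) hi mxE.
Qed.

Lemma monomial_word_RM r A : (#|A| <= r)%N -> monomial_word A \in RM r m.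
Proof. by move=> h; apply/memv_span/image_f; rewrite inE. Qed.

Lemma RM_ind r (P : 'rV['F_2]_(2 ^ m) -> Prop) :
  P 0 ->
  (forall A v, (#|A| <= r)%N -> P v -> P (monomial_word A + v)) ->
  forall v, v \in RM r m -> P v.
Proof.
move=> P0 PD; apply: span_F2_ind => // x v /imageP[A]; rewrite inE => hA ->.
exact: PD.
Qed.

(** The indicator of the subcube is the product of the factors x_i + z_i + 1 over i in [A], a
    polynomial of degree at most [#|A|]; [c B] is its coefficient at the monomial of [B]. *)
Lemma cube_word_RM r A z : (#|A| <= r)%N -> cube_word A z \in RM r m.
Proof.
move=> hA.
pose c B : 'F_2 := \prod_(i in ~: B) (if i \in A then z 0 i + 1 else 1).
have -> : cube_word A z =
    \sum_(B : {set 'I_m}) (if B \subset A then c B else 0) *: monomial_word B.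
  apply/rowP => j; rewrite mxE summxE.
  (* A coordinate outside [A] contributes the factor 0 + 1, so the product runs over all coordinates
     and expands over all subsets [B]; those not contained in [A] give 0. *)
  transitivity (\prod_i ((if i \in A then bits j 0 i else 0) +
                         (if i \in A then z 0 i + 1 else 1))).
    rewrite /in_cube; case: forall_inP => h.
      rewrite big1 // => i _; case: ifP => [/h/eqP -> | _]; last by rewrite add0r.
      by rewrite addrA F2_addxx add0r.
    case: (pickP [pred i in A | bits j 0 i != z 0 i]) => [i /andP[iA hi] | hh].
      rewrite (bigD1 i) //= iA (F2E (bits _ _ _)) (F2E (z _ _)) addrA.
      move: hi; rewrite (F2E (bits _ _ _)) (F2E (z _ _)).
      by do 2!case: (_ == 0) => //=; rewrite ?addr0 ?add0r ?F2_addxx ?mul0r.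
    by case: h => i iA; have := hh i; rewrite /= iA => /negbFE.
  rewrite bigA_distr; apply: eq_bigr => B _; rewrite !mxE.
  rewrite (bigID (mem B)) /=; case: ifP => [/subsetP sBA | /negbT/subsetPn[i iB iA]].
    rewrite mulrC; congr (_ * _).
      rewrite /c; apply: eq_big => [i|i /negPf ->] //; by rewrite inE.
    by apply: eq_bigr => i iB; rewrite iB sBA.
  by rewrite (bigD1 i) //= iB (negPf iA) !mul0r.
apply: memv_suml => B _; case: ifP => [sBA|_]; last by rewrite scale0r mem0v.
by apply/memvZ/monomial_word_RM/(leq_trans (subset_leq_card sBA)).
Qed.

(* Halve [T] along a coordinate on which two of its points differ, and recurse in
   the smaller half. *)
Lemma isolating_cube s (T : {set 'I_(2 ^ m)}) : T != set0 -> (#|T| < 2 ^ s.+1)%N ->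
  exists A j0, [/\ (#|A| <= s)%N, j0 \in T &
    forall j, j \in T -> in_cube A (bits j0) j -> j = j0].
Proof.
have single s' U : U != set0 -> (#|U| <= 1)%N -> exists A j0,
    [/\ (#|A| <= s')%N, j0 \in U & forall j, j \in U -> in_cube A (bits j0) j -> j = j0].
  rewrite -card_gt0 => U0 U1; have /cards1P[j0 ->] : #|U| == 1%N by rewrite eqn_leq U1.
  by exists set0, j0; rewrite cards0 set11; split=> // j /set1P.
elim: s T => [|s IHs] T T0 hT; first exact: single.
have [T1|T1] := leqP #|T| 1; first exact: single.
have /card_gt1P[x [y [xT yT xy]]] := T1.
have /rV0Pn[i hi] : bits x - bits y != 0.
  by rewrite subr_eq0 (inj_eq (bij_inj (@bits_bij m))).
have {}hi : bits x 0 i != bits y 0 i by move: hi; rewrite !mxE subr_eq0.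
pose U b := [set j in T | bits j 0 i == b].
have cardU b c : b != c -> (#|U b| + #|U c| <= #|T|)%N.
  move=> bc; rewrite -cardsUI.
  have -> : U b :&: U c = set0.
    apply/setP => j; rewrite !inE; case: eqP => [-> |]; last by rewrite andbF.
    by rewrite (negPf bc) !andbF.
  rewrite cards0 addn0; apply/subset_leq_card/subsetP => j.
  by rewrite !inE => /orP[] /andP[].
have [b [Ub0 Ub]] : exists b, U b != set0 /\ (#|U b| < 2 ^ s.+1)%N.
  have [h|h] := ltnP #|U (bits x 0 i)| (2 ^ s.+1).
    by exists (bits x 0 i); split=> //; apply/set0Pn; exists x; rewrite inE xT eqxx.
  exists (bits y 0 i); split; first by apply/set0Pn; exists y; rewrite inE yT eqxx.
  rewrite -(ltn_add2l (2 ^ s.+1)); apply: leq_ltn_trans (leq_add h (leqnn _)) _.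
  by apply: leq_ltn_trans (cardU _ _ hi) _; rewrite addnn -mul2n -expnS.
have [A [j0 [hA]]] := IHs _ Ub0 Ub; rewrite inE => /andP[j0T /eqP j0b hj0].
exists (i |: A), j0; split=> //.
  by rewrite cardsU1 -add1n; apply: leq_add hA; case: (_ \notin _).
move=> j jT; rewrite in_cubeU => /andP[/forall_inP/(_ i (set11 i)) hji hjA].
by apply: hj0 => //; rewrite inE jT (eqP hji) j0b /=.
Qed.

(** If the support were smaller, a subcube of codimension at most [r] would meet it in one point;
    its indicator lies in RM(r,m) and has inner product 1 with [f]. *)
Lemma RM_dual_min_distance r (f : 'rV['F_2]_(2 ^ m)) :
  f \in dual_code (RM r m) -> f != 0 -> (2 ^ r.+1 <= hweight f)%N.
Proof.
rewrite mem_dual_code => /forall_inP hf f0; rewrite leqNgt; apply/negP => hw.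
have [|A [j0 [hA]]] := isolating_cube _ hw.
  by have /rV0Pn[j hj] := f0; apply/set0Pn; exists j; rewrite inE.
rewrite inE => fj0 hj; move/(_ _ (cube_word_RM (bits j0) hA)): hf.
rewrite row_dot0 row_dotE (bigD1 j0) //= mxE.
have -> : in_cube A (bits j0) j0 by apply/forall_inP.
rewrite mulr1 big1 ?addr0; first by rewrite (negPf fj0).
move=> j jj0; rewrite mxE; have [-> |fj] := eqVneq (f 0 j) 0; first by rewrite mul0r.
case: (boolP (in_cube _ _ _)) => [/hj|_]; last by rewrite mulr0.
by rewrite inE => /(_ fj) /eqP; rewrite (negPf jj0).
Qed.

(** By bilinearity it suffices to pair two monomials. Their product is the indicator of a subcube of
    positive dimension, which has an even number of points. *)
Lemma RM_sub_dual r s : (r + s < m)%N -> (RM s m <= dual_code (RM r m))%VS.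
Proof.
move=> rsm; apply/subvP => v vs; rewrite mem_dual_code; apply/forall_inP => u ur.
apply/eqP; move: v vs; apply: RM_ind => [|B v hB IHv]; first by rewrite mul0mx.
rewrite mulmxDl IHv addr0; move: {IHv} u ur; apply: RM_ind => [|A u hA IHu].
  by rewrite trmx0 mulmx0.
rewrite linearD mulmxDr IHu addr0; apply/eqP; rewrite row_dot0 row_dotE.
have cAB : (#|B :|: A| < m)%N.
  by apply: leq_ltn_trans rsm; rewrite addnC; apply: leq_trans (leq_card_setU _ _) (leq_add hB hA).
apply/eqP; transitivity ((2 ^ (m - #|B :|: A|))%:R : 'F_2); last first.
  by rewrite F2_natr oddX subn_eq0 leqNgt cAB.
rewrite -(card_cube _ (const_mx 1)) -sum1dep_card natr_sum [RHS]big_mkcond /=.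
apply: eq_bigr => j _; rewrite !monomial_wordE !mxE in_cubeU.
by do 2!case: in_cube; rewrite /= ?mulr0 ?mulr1.
Qed.

(** RM(r,m) lies in the dual of RM(m-r-1,m), so the bound for dual codes applies with m-r-1 in place
    of r. *)
Lemma RM_min_distance r (f : 'rV['F_2]_(2 ^ m)) :
  (r < m)%N -> f \in RM r m -> f != 0 -> (2 ^ (m - r) <= hweight f)%N.
Proof.
move=> rm fr; have -> : (m - r = (m - r.+1).+1)%N by rewrite subnSK.
by apply/RM_dual_min_distance/(subvP (RM_sub_dual _) _ fr); rewrite -addnS subnK.
Qed.

(* Add the monomials of [h] one at a time, with [wt (f + h) + 2 wt (f h) = wt f + wt h]:
   the product term has one more monomial factor, but also an extra factor 2. *)
Lemma RM_cube_weight_dvd r A t (h : 'rV['F_2]_(2 ^ m)) : (0 < r)%N ->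
  h \in RM r m -> (#|A| <= t * r)%N ->
  (2 ^ (m %/ r - t.+1) %| #|[set j | in_cube A (const_mx 1%R) j & h 0%R j != 0%R]|)%N.
Proof.
move=> r0 hr; move: h hr A t.
apply: RM_ind => [|B h hB IHh] A t hA.
  rewrite (_ : [set j | _] = set0) ?cards0 ?dvdn0 //.
  by apply/setP => j; rewrite !inE mxE eqxx andbF.
pose N A (h : 'rV['F_2]_(2 ^ m)) := #|[set j | in_cube A (const_mx 1%R) j & h 0%R j != 0%R]|.
have hAB : (#|A :|: B| <= t.+1 * r)%N.
  by rewrite mulSn addnC; apply: leq_trans (leq_card_setU _ _) (leq_add hA hB).
(* Inside the subcube of [A], the monomial of [B] is the indicator of the subcube of [A :|: B], and
   multiplying [h] by it restricts [h] to that smaller subcube. *)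
have e : (2 * N (A :|: B) h + N A (monomial_word B + h)%R = 2 ^ (m - #|A :|: B|) + N A h)%N.
  have cE (P : pred 'I_(2 ^ m)) : #|[set j | P j]| = (\sum_j P j)%N.
    by rewrite -sum1dep_card big_mkcond.
  rewrite -(card_cube _ (const_mx 1)) /N !cE big_distrr -!big_split.
  apply: eq_bigr => j _; rewrite /= in_cubeU monomial_wordE !mxE (F2E (h 0%R j)).
  by do 2!case: in_cube; case: (h 0%R j == 0%R).
rewrite -(dvdn_addr (m := 2 * N (A :|: B) h)); last first.
  (* In the first case truncated subtraction makes the exponent 0. In the second, the factor 2 makes
     up for the exponent lost by passing from [t] to [t.+1]. *)
  have [h1|h1] := leqP (m %/ r) t.+1.
    by rewrite (eqP (_ : _ - _ == 0)%N) ?dvd1n // subn_eq0.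
  rewrite -(subnSK h1) expnS; apply: dvdn_mul => //; exact: IHh.
rewrite -[X in (_ %| X)%N]/(2 * N (A :|: B) h + N A (monomial_word B + h)%R)%N e.
rewrite dvdn_addl; last exact: IHh.
(* The exponents compare by m/r - (t+1) <= (m/r - (t+1)) r <= m - (t+1) r, with m/r rounded down. *)
apply: dvdn_exp2l; apply: leq_trans (leq_sub2l m hAB).
apply: leq_trans (leq_pmulr _ r0) _.
by rewrite mulnBl leq_sub2r // leq_trunc_div.
Qed.

Lemma RM_weight_dvd r (h : 'rV['F_2]_(2 ^ m)) : (0 < r)%N ->
  h \in RM r m -> (2 ^ (m %/ r - 1) %| hweight h)%N.
Proof.
move=> r0 hr; have := @RM_cube_weight_dvd r set0 0 h r0 hr.
rewrite cards0 (_ : [set j | _] = [set j | h 0%R j != 0%R]); first exact.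
apply/setP => j; rewrite !inE (_ : in_cube _ _ _) //.
by apply/forall_inP => i; rewrite inE.
Qed.

End ReedMuller.

(** * Deleting and restoring a coordinate *)

Lemma sum_lift_ord (V : nmodType) N (p : 'I_N) (F : 'I_N -> V) :
  \sum_i F i = F p + \sum_i F (lift p i).
Proof. exact: bigD1_ord. Qed.

Lemma hweight_col' N (p : 'I_N) (c : 'rV['F_2]_N) :
  hweight c = ((c 0%R p != 0%R) + hweight (col' p c))%N.
Proof.
rewrite !hweightE; apply: etrans (sum_lift_ord p _) _; congr (_ + _)%N.
by apply: eq_bigr => i _; rewrite mxE.
Qed.

Lemma row_dot_col' N (p : 'I_N) (x y : 'rV['F_2]_N) :
  (x *m y^T) 0 0 = x 0 p * y 0 p + (col' p x *m (col' p y)^T) 0 0.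
Proof.
rewrite !row_dotE (sum_lift_ord p); congr (_ + _).
by apply: eq_bigr => i _; rewrite !mxE.
Qed.

Definition uncol' N (p : 'I_N) (a : 'F_2) (b : 'rV['F_2]_N.-1) : 'rV['F_2]_N :=
  \row_j if unlift p j is Some k then b 0 k else a.

Lemma uncol'_p N (p : 'I_N) a b : uncol' p a b 0 p = a.
Proof. by rewrite mxE unlift_none. Qed.

Lemma col'_uncol' N (p : 'I_N) a b : col' p (uncol' p a b) = b.
Proof. by apply/rowP => i; rewrite !mxE liftK. Qed.

Lemma uncol'_col' N (p : 'I_N) (c : 'rV['F_2]_N) : uncol' p (c 0 p) (col' p c) = c.
Proof. by apply/rowP => j; rewrite mxE; case: unliftP => [k|] ->; rewrite ?mxE. Qed.

Lemma odd_hweightD n (x y : 'rV['F_2]_n) :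
  odd (hweight (x + y)) = odd (hweight x) (+) odd (hweight y).
Proof.
suff : (odd (hweight (x + y)))%:R = (odd (hweight x) (+) odd (hweight y))%:R :> 'F_2.
  by do 2!case: (odd _) => //=; case: (odd _).
rewrite -row_dot_const1 mulmxDl mxE !row_dot_const1.
by do 2!case: odd; rewrite /= ?addr0 ?add0r ?F2_addxx.
Qed.

(** * The punctured code, its even subcode and their odd-weight minimum distances *)

Section PuncturedReedMuller.
Variables (m r : nat) (p : 'I_(2 ^ m)).
Hypotheses (r_gt0 : (0 < r)%N) (r_le : (r <= m %/ 2)%N).
Let C1 := puncturedRM r p.
Let E := even_code C1.

Let r2m : (2 * r <= m)%N.
Proof. by rewrite mulnC -leq_divRL. Qed.

Let rm : (r < m)%N.
Proof. by apply: leq_trans r2m; rewrite mul2n -addnn -addn1 leq_add2l. Qed.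

Lemma mem_puncturedRM a :
  reflect (exists2 c, c \in RM r m & a = col' p c) (a \in C1).
Proof.
apply: (iffP memv_imgP) => -[c cr ->]; exists c => //; by rewrite lfunE.
Qed.

(** From [r <= m %/ 2] one gets [m %/ r >= 2], so the power of 2 dividing all weights is at least
    2. *)
Let even_RM c : c \in RM r m -> ~~ odd (hweight c).
Proof.
move=> cr; rewrite -dvdn2; apply: dvdn_trans (RM_weight_dvd r_gt0 cr).
by rewrite -{1}(expn1 2) dvdn_exp2l // subn_gt0 leq_divRL.
Qed.

Let odd_col' c : c \in RM r m -> odd (hweight (col' p c)) = (c 0 p != 0).
Proof.
move/even_RM; rewrite (hweight_col' p) oddD oddb.
by case: (c 0 p != 0); case: odd.
Qed.

Lemma const1_puncturedRM : const_mx 1 \in C1.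
Proof.
apply/mem_puncturedRM; exists (cube_word set0 0); first by rewrite cube_word_RM ?cards0.
apply/rowP => i; rewrite !mxE (_ : in_cube _ _ _) //.
by apply/forall_inP => k; rewrite inE.
Qed.

Lemma puncturedRM_even_weight a :
  a \in C1 -> ~~ odd (hweight a) -> (2 ^ (m %/ r - 1) %| hweight a)%N.
Proof.
case/mem_puncturedRM => c cr ->; rewrite odd_col' // negbK => cp.
by have := RM_weight_dvd r_gt0 cr; rewrite (hweight_col' p) cp.
Qed.

Lemma puncturedRM_odd_weight a :
  a \in C1 -> odd (hweight a) -> (2 ^ (m %/ r - 1) %| (hweight a).+1)%N.
Proof.
case/mem_puncturedRM => c cr ->; rewrite odd_col' // => cp.
by have := RM_weight_dvd r_gt0 cr; rewrite (hweight_col' p) cp.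
Qed.

Lemma puncturedRM_odd_min a :
  a \in C1 -> odd (hweight a) -> (2 ^ (m - r) - 1 <= hweight a)%N.
Proof.
case/mem_puncturedRM => c cr ->; rewrite odd_col' // => cp.
have c0 : c != 0 by apply/rV0Pn; exists p.
by have := RM_min_distance rm cr c0; rewrite (hweight_col' p) cp leq_subLR.
Qed.

(** The witness is a subcube of codimension [r] through [p]: it has 2^(m-r) points and loses exactly
    [p]. *)
Lemma puncturedRM_odd_min_attained :
  exists2 a, a \in C1 & odd (hweight a) /\ hweight a = (2 ^ (m - r) - 1)%N.
Proof.
have [A cA] : exists A : {set 'I_m}, #|A| = r.
  exists [set widen_ord (ltnW rm) i | i : 'I_r].
  by rewrite card_imset ?cardsT ?card_ord // => i j /(congr1 val) /= /val_inj.
pose c := cube_word A (bits p).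
have cr : c \in RM r m by rewrite cube_word_RM ?cA.
have cp : c 0 p != 0 by rewrite mxE (_ : in_cube _ _ _) //; apply/forall_inP.
exists (col' p c); first by apply/mem_puncturedRM; exists c.
rewrite odd_col' // cp; split=> //.
by rewrite -cA -(hweight_cube _ (bits p)) (hweight_col' p) cp add1n subn1.
Qed.

Lemma odd_hweight_const1 : odd (hweight (const_mx 1 : 'rV['F_2]_(2 ^ m).-1)).
Proof.
rewrite hweightE (eq_bigr (fun=> 1%N)) => [|i _]; last by rewrite mxE.
rewrite sum1_card card_ord -subn1 oddB ?expn_gt0 //= oddX /= orbF.
by rewrite -(prednK (leq_ltn_trans _ rm)).
Qed.

(** A word of RM(r,m) punctures into [E] if its bit at [p] is 0, and into [E] plus the all-ones word
    if it is 1. In the second case the pairing of [b] with all-ones is 1, and the restored bit 1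
    cancels it. *)
Lemma mem_dual_even_uncol' b : odd (hweight b) ->
  (b \in dual_code E) = (uncol' p 1 b \in dual_code (RM r m)).
Proof.
move=> ob; rewrite !mem_dual_code; apply/forall_inP/forall_inP => h c hc.
  have ca : col' p c \in C1 by apply/mem_puncturedRM; exists c.
  rewrite row_dot0 (row_dot_col' p) uncol'_p col'_uncol' mul1r (F2E (c 0 p)) -odd_col' //.
  case: (boolP (odd _)) => oc; last first.
    by rewrite add0r -row_dot0; apply: h; rewrite mem_even_code ca.
  have /h : col' p c + const_mx 1 \in E.
    by rewrite mem_even_code memvD ?const1_puncturedRM //= odd_hweightD oc odd_hweight_const1.
  rewrite row_dot0 linearD mulmxDr mxE row_dot_const1 ob => /eqP e.
  by rewrite addrC e.
move: hc; rewrite mem_even_code => /andP[/mem_puncturedRM[d dr ->]].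
rewrite odd_col' // negbK => /eqP dp.
by move/h: dr; rewrite !row_dot0 (row_dot_col' p) dp mulr0 add0r col'_uncol'.
Qed.

Lemma dual_even_min b : b \in dual_code E -> odd (hweight b) -> (2 ^ r.+1 - 1 <= hweight b)%N.
Proof.
move=> bE ob; move: bE; rewrite mem_dual_even_uncol' // => /RM_dual_min_distance.
rewrite (hweight_col' p) uncol'_p col'_uncol' leq_subLR; apply.
by apply/rV0Pn; exists p; rewrite uncol'_p.
Qed.

(** The witness is a subcube of dimension r+1 through [p]; its indicator lies in RM(m-r-1,m), hence
    in the dual of RM(r,m). *)
Lemma dual_even_min_attained :
  exists2 b, b \in dual_code E & odd (hweight b) /\ hweight b = (2 ^ r.+1 - 1)%N.
Proof.
have r1m : (m - r.+1 <= m)%N by rewrite leq_subr.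
have [A cA] : exists A : {set 'I_m}, #|A| = (m - r.+1)%N.
  exists [set widen_ord r1m i | i : 'I_(m - r.+1)].
  by rewrite card_imset ?cardsT ?card_ord // => i j /(congr1 val) /= /val_inj.
pose c := cube_word A (bits p).
have cr : c \in RM (m - r.+1) m by rewrite cube_word_RM ?cA.
have cp : c 0 p = 1 by rewrite mxE (_ : in_cube _ _ _) //; apply/forall_inP.
have cE : uncol' p 1 (col' p c) = c.
  by rewrite -cp uncol'_col'.
have hc : (hweight (col' p c)).+1 = (2 ^ r.+1)%N.
  rewrite -(subKn rm) -cA -(hweight_cube _ (bits p)) -/c (hweight_col' p c) cp; exact: add1n.
have oc : odd (hweight (col' p c)).
  by move/(congr1 odd): hc; rewrite oddX /=; case: odd.
exists (col' p c); last by rewrite -hc subn1.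
rewrite mem_dual_even_uncol' // cE; apply: (subvP (RM_sub_dual _)) cr.
by rewrite -addSn subnKC.
Qed.

End PuncturedReedMuller.

(** * Matrices with one nonzero entry per row, and characters of F_2^n *)

Lemma bits_sig n (x : 'rV['F_2]_n) : {j | bits j = x}.
Proof.
case: (pickP (fun j => bits j == x)) => [j /eqP | h]; first by exists j.
by exfalso; have [g _ gK] := bits_bij n; have := h (g x); rewrite gK eqxx.
Qed.

(** [bits_bij] asserts an inverse in [Prop] only; a search through the finite index type yields it
    as a function. *)
Definition unbits n (x : 'rV['F_2]_n) : 'I_(2 ^ n) := sval (bits_sig x).

Lemma unbitsK n : cancel (@unbits n) (@bits n).
Proof. by move=> x; rewrite /unbits; case: bits_sig. Qed.

Lemma bitsK n : cancel (@bits n) (@unbits n).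
Proof. by move=> j; apply: (bij_inj (@bits_bij n)); rewrite unbitsK. Qed.

Section Monomial.
Local Open Scope sesquilinear_scope.
Variable C : numClosedFieldType.

Section MonomialMatrix.
Variable n : nat.
Implicit Types (a b x : 'rV['F_2]_n) (f g : 'rV['F_2]_n -> C) (v : 'cV[C]_(2 ^ n)).

(* In the basis labelled by F_2^n: |x + a> |-> f(x) |x>. Pauli operators and tensor
   products of diagonal gates both have this form. *)
Definition monomx a f : 'M[C]_(2 ^ n) :=
  \matrix_(i, j) ((bits j == bits i + a)%:R * f (bits i)).

(** The amplitude of |x> in [v]; through it, state vectors are treated as functions on F_2^n. *)
Definition amp v x : C := v (unbits x) 0.

Lemma amp_inj v w : amp v =1 amp w -> v = w.
Proof. by move=> e; apply/colP => i; rewrite -(bitsK i); apply: e. Qed.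

Lemma ampZ c v x : amp (c *: v) x = c * amp v x.
Proof. by rewrite /amp mxE. Qed.

Lemma ampD v w x : amp (v + w) x = amp v x + amp w x.
Proof. by rewrite /amp mxE. Qed.

Lemma amp_ket x y : amp (ket C y) x = (x == y)%:R.
Proof. by rewrite /amp mxE unbitsK. Qed.

Lemma addF2K a : involutive (fun x => x + a).
Proof. by move=> x; rewrite -addrA F2mx_addxx addr0. Qed.

Lemma amp_monomx a f v x : amp (monomx a f *m v) x = f x * amp v (x + a).
Proof.
rewrite /amp mxE (bigD1 (unbits (x + a))) //= mxE !unbitsK eqxx mul1r big1 ?addr0 //.
move=> j hj; rewrite mxE unbitsK; case: eqP => [e|]; last by rewrite !mul0r.
by rewrite -e bitsK eqxx in hj.
Qed.

Lemma eq_monomx a b f g : a = b -> f =1 g -> monomx a f = monomx b g.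
Proof. by move=> -> fg; apply/matrixP => i j; rewrite !mxE fg. Qed.

Lemma monomx_mul a b f g :
  monomx a f *m monomx b g = monomx (a + b) (fun x => f x * g (x + a)).
Proof.
apply/matrixP => i j; rewrite !mxE (bigD1 (unbits (bits i + a))) //= !mxE unbitsK eqxx.
rewrite mul1r addrA big1 ?addr0 => [|k hk]; first by rewrite mulrCA.
rewrite mxE; case: eqP => [e|]; last by rewrite !mul0r.
by rewrite -e bitsK eqxx in hk.
Qed.

Lemma monomx_scale c a f : c *: monomx a f = monomx a (fun x => c * f x).
Proof. by apply/matrixP => i j; rewrite !mxE mulrCA. Qed.

Lemma monomx1 : monomx 0 (fun=> 1) = 1%:M.
Proof.
apply/matrixP => i j; rewrite !mxE addr0 mulr1 eq_sym.
by rewrite (inj_eq (bij_inj (@bits_bij n))).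
Qed.

Lemma monomx_adj a f : (monomx a f)^t* = monomx a (fun x => (f (x + a))^*).
Proof.
apply/matrixP => i j; rewrite !mxE rmorphM /= rmorph_nat.
have -> : (bits i == bits j + a) = (bits j == bits i + a).
  by apply/eqP/eqP => ->; rewrite addF2K.
by case: eqP => [->|_]; rewrite ?mul0r // addF2K.
Qed.

(** As [f] vanishes nowhere, the positions of the nonzero entries determine the translation [a], and
    then the entries determine [f]. *)
Lemma monomx_inj a b f g : (forall x, f x != 0) -> monomx a f = monomx b g -> a = b /\ f =1 g.
Proof.
move=> f0 e; have {}e x : f x = (x + a == x + b)%:R * g x.
  have /matrixP/(_ (unbits x) (unbits (x + a))) := e.
  by rewrite !mxE !unbitsK eqxx mul1r.
have ab : a = b.
  by have := f0 0; rewrite e !add0r; have [->|_] := eqVneq a b; rewrite ?mul0r ?eqxx.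
by split=> // x; rewrite e ab eqxx mul1r.
Qed.

Lemma tens_monomx (A : 'I_n -> 'M[C]_2) a (g : 'I_n -> 'F_2 -> C) :
  (forall k (b c : 'F_2), A k b c = (c == b + a 0 k)%:R * g k b) ->
  tens A = monomx a (fun x => \prod_k g k (x 0 k)).
Proof.
move=> hA; apply/matrixP => i j; rewrite !mxE (eq_bigr _ (fun k _ => hA k _ _)).
rewrite big_split /=; congr (_ * _); case: eqP => [-> | h].
  by rewrite big1 // => k _; rewrite [in X in X == _]mxE eqxx.
case: (pickP (fun k => bits j 0 k != bits i 0 k + a 0 k)) => [k hk | hh].
  by rewrite (bigD1 k) //= (negPf hk) mul0r.
by case: h; apply/rowP => k; have /negbFE/eqP -> := hh k; rewrite [RHS]mxE.
Qed.

Lemma monomx_unitary a f : (forall x, `|f x| = 1) -> monomx a f \is unitarymx.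
Proof.
move=> f1; apply/unitarymxP; rewrite monomx_adj monomx_mul F2mx_addxx -monomx1.
by apply: eq_monomx => // x; rewrite addF2K -normCK f1 expr1n.
Qed.

(** The nontrivial additive character of F_2. *)
Definition chi (u : 'F_2) : C := (-1) ^+ (u != 0).

Lemma chi0 : chi 0 = 1.
Proof. by rewrite /chi eqxx. Qed.

Lemma chiD (u v : 'F_2) : chi (u + v) = chi u * chi v.
Proof.
rewrite (F2E u) (F2E v); case: (u == 0); case: (v == 0);
  by rewrite /= ?addr0 ?add0r ?F2_addxx ?chi0 ?mulr1 ?mul1r // /chi oner_eq0 -expr2 sqrr_sign.
Qed.

Lemma chi_eq1 u : (chi u == 1) = (u == 0).
Proof.
rewrite /chi; have [_|_] := eqVneq u 0; first by rewrite eqxx.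
by rewrite expr1 -subr_eq0 -opprD oppr_eq0 -mulr2n pnatr_eq0.
Qed.

Lemma chi_inj : injective chi.
Proof.
move=> u v e; have : chi (u + v) == 1 by rewrite chiD e -chiD F2_addxx chi0.
by rewrite chi_eq1 => /eqP uv; rewrite -[u]addr0 -(F2_addxx v) addrA uv add0r.
Qed.

(** The sign by which the product of Z's on the support of [b] acts on |x>. *)
Definition sgn b x : C := chi ((b *m x^T) 0 0).

Lemma sgnC b x : sgn b x = sgn x b.
Proof. by rewrite /sgn !row_dotE; congr chi; apply: eq_bigr => i _; rewrite mulrC. Qed.

Lemma sgnD b x y : sgn b (x + y) = sgn b x * sgn b y.
Proof. by rewrite /sgn linearD mulmxDr mxE chiD. Qed.

Lemma sgn0 b : sgn b 0 = 1.
Proof. by rewrite /sgn trmx0 mulmx0 mxE chi0. Qed.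

Lemma sgn0l x : sgn 0 x = 1.
Proof. by rewrite sgnC sgn0. Qed.

Lemma norm_sgn b x : `|sgn b x| = 1.
Proof. by rewrite /sgn /chi normrX normrN1 expr1n. Qed.

Lemma sgn_neq0 b x : sgn b x != 0.
Proof. by rewrite -normr_eq0 norm_sgn oner_eq0. Qed.

Lemma sgn_prod b x : sgn b x = \prod_k chi (b 0 k * x 0 k).
Proof. by rewrite /sgn row_dotE; apply: (big_morph chi chiD chi0). Qed.

Lemma sgn_eq1 b x : (sgn b x == 1) = (b *m x^T == 0).
Proof. by rewrite chi_eq1 row_dot0. Qed.

Lemma sgn_inj b b' : sgn b =1 sgn b' -> b = b'.
Proof.
move=> e; apply/rowP => k; have := e (delta_mx 0 k); rewrite /sgn.
by rewrite trmx_delta -!colE !mxE => /chi_inj.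
Qed.

Lemma mem_dualP (D : code n) x :
  reflect (forall c, c \in D -> sgn x c = 1) (x \in dual_code D).
Proof.
rewrite mem_dual_code; apply: (iffP forall_inP) => h c /h.
  by rewrite -sgn_eq1 => /eqP.
by move/eqP; rewrite sgn_eq1.
Qed.

End MonomialMatrix.

(** * Pauli operators and phase gates as monomial matrices *)

Definition pauli_x P : 'F_2 := if P is (PX | PY) then 1 else 0.
Definition pauli_z P : 'F_2 := if P is (PZ | PY) then 1 else 0.
(** In [monomx] the sign is read at the row, after the translation; hence Y is written as -i Z X. *)
Definition pauli_phase P : C := if P is PY then - 'i else 1.

Lemma pauli_mxE P (b c : 'F_2) :
  pauli_mx C P b c = (c == b + pauli_x P)%:R * (pauli_phase P * chi (pauli_z P * b)).
Proof.
rewrite (F2E b) (F2E c).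
by case: P; case: (b == 0); case: (c == 0); rewrite mxE /chi /=
  ?mul0r ?mul1r ?mulr1 ?mulr0 ?addr0 ?add0r ?F2_addxx ?eqxx ?oner_eq0 //=
  ?mul1r ?mulr1 ?mul0r ?mulrN1 ?opprK.
Qed.

Lemma norm_pauli_phase P : `|pauli_phase P| = 1.
Proof. by case: P; rewrite /= ?normr1 // normrN normCi. Qed.

Definition xpart n (P : 'I_n -> pauli) : 'rV['F_2]_n := \row_k pauli_x (P k).
Definition zpart n (P : 'I_n -> pauli) : 'rV['F_2]_n := \row_k pauli_z (P k).
Definition phase n (P : 'I_n -> pauli) : C := \prod_k pauli_phase (P k).

Lemma pauli_opE n (P : 'I_n -> pauli) :
  pauli_op C P = monomx (xpart P) (fun x => phase P * sgn (zpart P) x).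
Proof.
rewrite /pauli_op (tens_monomx (a := xpart P)
  (g := fun k b => pauli_phase (P k) * chi (pauli_z (P k) * b))) => [|k b c].
  apply: eq_monomx => // x; rewrite sgn_prod -big_split.
  by apply: eq_bigr => k _; rewrite mxE.
by rewrite pauli_mxE mxE.
Qed.

Lemma norm_phase n (P : 'I_n -> pauli) : `|phase P| = 1.
Proof. by rewrite normr_prod big1 // => k _; apply: norm_pauli_phase. Qed.

Definition pauli_of n (a b : 'rV['F_2]_n) (k : 'I_n) : pauli :=
  if a 0 k == 0 then (if b 0 k == 0 then PI else PZ)
  else (if b 0 k == 0 then PX else PY).

Lemma xpart_of n (a b : 'rV['F_2]_n) : xpart (pauli_of a b) = a.
Proof.
apply/rowP => k; rewrite mxE /pauli_of [RHS]F2E.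
by case: (a 0 k == 0); case: (b 0 k == 0).
Qed.

Lemma zpart_of n (a b : 'rV['F_2]_n) : zpart (pauli_of a b) = b.
Proof.
apply/rowP => k; rewrite mxE /pauli_of [RHS]F2E.
by case: (a 0 k == 0); case: (b 0 k == 0).
Qed.

Lemma pauli_weightE n (P : 'I_n -> pauli) :
  pauli_weight P = #|[set k | (xpart P 0%R k != 0%R) || (zpart P 0%R k != 0%R)]|.
Proof. by apply: eq_card => k; rewrite !inE !mxE; case: (P k). Qed.

(** The constant 1 is written [sgn 0], so that both kinds of generator have the shape
    [monomx a (sgn b)]. *)
Lemma pauli_on_XE n (c : 'rV['F_2]_n) : pauli_on C PX c = monomx c (sgn 0).
Proof.
have c1 k : c 0 k = (c 0 k == 1)%:R by rewrite {1}(F2E (c 0 k)); case: (c 0 k) => -[|[|]].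
rewrite /pauli_on pauli_opE; apply: eq_monomx => [|x].
  by apply/rowP => k; rewrite mxE [RHS]c1; case: ifP.
rewrite /phase big1 ?mul1r => [|k _]; last by case: ifP.
by congr sgn; apply/rowP => k; rewrite !mxE; case: ifP.
Qed.

Lemma pauli_on_ZE n (c : 'rV['F_2]_n) : pauli_on C PZ c = monomx 0 (sgn c).
Proof.
have c1 k : c 0 k = (c 0 k == 1)%:R by rewrite {1}(F2E (c 0 k)); case: (c 0 k) => -[|[|]].
rewrite /pauli_on pauli_opE; apply: eq_monomx => [|x].
  by apply/rowP => k; rewrite !mxE; case: ifP.
rewrite /phase big1 ?mul1r => [|k _]; last by case: ifP.
by congr sgn; apply/rowP => k; rewrite mxE [RHS]c1; case: ifP.
Qed.

Lemma tens_phase_gate n (w : C) :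
  tens (fun _ : 'I_n => mx2 1 0 0 w) = monomx 0 (fun x => w ^+ hweight x).
Proof.
rewrite (tens_monomx (a := 0) (g := fun _ b => w ^+ (b != 0))) => [|k b c].
  by apply: eq_monomx => // x; rewrite hweightE expr_sum.
rewrite !mxE addr0 (F2E b) (F2E c).
by case: (b == 0); case: (c == 0); rewrite /= ?eqxx ?oner_eq0 ?mul1r
  ?mul0r ?expr0 ?expr1 // eq_sym oner_eq0 mul0r.
Qed.

(** * The CSS code: stabilizer, code space, logical operators and distance *)

Section CSS.
Variables (n : nat) (C1 C2 : code n).
Hypothesis const1_C1 : const_mx 1 \in C1.
Hypothesis odd_n : odd (hweight (const_mx 1 : 'rV['F_2]_n)).
Hypothesis dual_C2 : dual_code C2 = even_code C1.
Let E := even_code C1.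
Let S : 'M[C]_(2 ^ n) -> Prop := css_stabilizer C1 C2.

Let E_sub a : a \in E -> a \in C1.
Proof. by rewrite mem_even_code => /andP[]. Qed.

Let addr_const1 a : a \in C1 -> (a + const_mx 1 \in E) = (a \notin E).
Proof.
by move=> aC; rewrite !mem_even_code memvD // aC /= odd_hweightD odd_n addbT.
Qed.

(** Modulo [E], the code [C1] is generated by the all-ones word, and pairing [b] with that word
    gives the parity of its weight. *)
Lemma mem_dual_odd b : b \in dual_code E -> (b \in dual_code C1) = ~~ odd (hweight b).
Proof.
move=> /(@mem_dualP _ E) bE; apply/(@mem_dualP _ C1)/idP => [/(_ _ const1_C1)/eqP | ob a aC].
  by rewrite chi_eq1 row_dot_const1; case: odd.
case: (boolP (a \in E)) => [/bE // | aE].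
have := bE _ (etrans (addr_const1 aC) aE); rewrite sgnD => h.
by move: h; rewrite [X in _ * X]/sgn row_dot_const1 (negPf ob) chi0 mulr1.
Qed.

(** X-parts in [E] and Z-parts in the dual of [C1] are orthogonal, so products pick up no sign. The
    operators of this form are thus closed under multiplication, and each is its own inverse. *)
Lemma css_stabilizerP s :
  S s <-> exists a b, [/\ a \in E, b \in dual_code C1 & s = monomx a (sgn b)].
Proof.
have sgnCE a b : a \in E -> b \in dual_code C1 -> sgn b a = 1.
  by move=> aE /mem_dualP; apply; apply: E_sub.
have mulE a b a' b' : a \in E -> b' \in dual_code C1 ->
    monomx a (sgn b) *m monomx a' (sgn b') = monomx (a + a') (sgn (b + b')).
  move=> aE bC; rewrite monomx_mul; apply: eq_monomx => // x.
  by rewrite [RHS]sgnC !sgnD !(sgnC x) (sgnCE a b') ?mulr1.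
split=> [|[a [b [aE bC ->]]]].
  elim=> [A | | A B _ [a [b [aE bC ->]]] _ [a' [b' [aE' bC' ->]]] | A _ [a [b [aE bC ->]]]].
  - rewrite /css_generator dual_C2 => -[[c cE ->] | [c cC ->]].
      by exists c, 0; rewrite pauli_on_XE mem0v.
    by exists 0, c; rewrite pauli_on_ZE mem0v.
  - exists 0, 0; rewrite !mem0v; split=> //; rewrite -monomx1.
    by apply: eq_monomx => // x; rewrite sgn0l.
  - by exists (a + a'), (b + b'); rewrite mulE // !memvD.
  exists a, b; split=> //.
  have e : monomx a (sgn b) *m monomx a (sgn b) = 1%:M.
    rewrite mulE // !F2mx_addxx -monomx1.
    by apply: eq_monomx => // x; rewrite sgn0l.
  have u : monomx a (sgn b) \in unitmx by case: (mulmx1_unit e).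
  by rewrite -[LHS]mulmx1 -e mulmxA mulVmx // mul1mx.
have -> : monomx a (sgn b) = monomx a (sgn 0) *m monomx 0 (sgn b).
  by rewrite mulE // addr0 add0r.
apply: gen_mul; apply: gen_in.
  by left; exists a; rewrite ?dual_C2 ?pauli_on_XE.
by right; exists b; rewrite ?pauli_on_ZE.
Qed.

(** The X generators impose periodicity. For [x] outside [C1], biduality gives a Z generator whose
    sign at [x] is not 1, which forces the amplitude there to be 0. *)
Lemma css_fixedP v : (forall s, S s -> s *m v = v) <->
  (forall a, a \in E -> forall x, amp v (x + a) = amp v x) /\
  (forall x, x \notin C1 -> amp v x = 0).
Proof.
split=> [fix_v | [vE vC] s /css_stabilizerP[a [b [aE bC ->]]]].
  split=> [a aE x | x xC].
    have /fix_v e : S (monomx a (sgn 0)) by apply/css_stabilizerP; exists a, 0; rewrite mem0v.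
    by rewrite -[in RHS]e amp_monomx sgn0l mul1r.
  move: xC; rewrite -(dual_codeK C1) mem_dual_code negb_forall_in.
  case/exists_inP => c cC; rewrite -sgn_eq1 => xc.
  have /fix_v e : S (monomx 0 (sgn c)) by apply/css_stabilizerP; exists 0, c; rewrite mem0v.
  have /eqP : amp v x = sgn c x * amp v x by rewrite -{1}e amp_monomx addr0.
  rewrite -subr_eq0 -{1}[amp v x]mul1r -mulrBl mulf_eq0 subr_eq0 eq_sym sgnC.
  by rewrite (negPf xc) => /eqP.
apply: amp_inj => x; rewrite amp_monomx vE //.
have [xC|xC] := boolP (x \in C1); last by rewrite vC // mulr0.
by have /mem_dualP/(_ _ xC) -> := bC; rewrite mul1r.
Qed.

Let N : C := (sqrtC #|dual_code C2|%:R)^-1.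

Let N_neq0 : N != 0.
Proof.
rewrite invr_eq0 sqrtC_eq0 pnatr_eq0 -lt0n; apply/card_gt0P.
by exists 0; rewrite mem0v.
Qed.

Lemma amp_css_ket a x : amp (css_ket C C2 a) x = N * (x + a \in E)%:R.
Proof.
rewrite ampZ -/N; congr (_ * _); rewrite dual_C2 -/E.
have -> : amp (\sum_(c in E) ket C (a + c)) x = \sum_(c in E) (x == a + c)%:R.
  by rewrite /amp summxE; apply: eq_bigr => c _; rewrite -[LHS]/(amp _ _) amp_ket.
have eqc c : (x == a + c) = (c == x + a).
  apply/eqP/eqP => ->; first by rewrite addrAC F2mx_addxx add0r.
    by rewrite addrCA F2mx_addxx addr0.
case: (boolP (x + a \in E)) => xa.
  rewrite (bigD1 (x + a)) //= eqc eqxx big1 ?addr0 // => c /andP[_ hc].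
  by rewrite eqc (negPf hc).
rewrite big1 // => c cE; rewrite eqc; case: eqP => // ce.
by rewrite -ce cE in xa.
Qed.

Lemma css_ket_fixed a s : a \in C1 -> S s -> s *m css_ket C C2 a = css_ket C C2 a.
Proof.
move=> aC; apply: (css_fixedP _).2; split=> [c cE x | x xC]; rewrite !amp_css_ket.
  have -> : x + c + a = x + a + c by rewrite addrAC.
  congr (_ * _%:R); congr nat_of_bool; apply/idP/idP => h; last exact: memvD.
  by rewrite -[x + a](addF2K c) memvD.
case: (boolP (_ \in E)) => [/E_sub h|]; last by rewrite mulr0.
by case/negP: xC; rewrite -[x](addF2K a) memvD.
Qed.

Let k0 := css_ket C C2 0.
Let k1 := css_ket C C2 (const_mx 1).

(** An [E]-periodic function supported on [C1] is determined by its values at 0 and at the all-ones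
    word, which represent the two cosets; dividing by [N] undoes the normalization. *)
Lemma fixed_css_ket v : (forall s, S s -> s *m v = v) ->
  v = (amp v 0 / N) *: k0 + (amp v (const_mx 1) / N) *: k1.
Proof.
move/css_fixedP => [vE vC]; apply: amp_inj => x.
rewrite ampD (ampZ _ k0) (ampZ _ k1) !amp_css_ket !mulrA !divfK // addr0.
have [xC|xC] := boolP (x \in C1); last first.
  rewrite vC // (_ : x \in E = false) ?mulr0 ?add0r.
    case: (boolP (_ \in E)) => [/E_sub h|]; last by rewrite mulr0.
    by case/negP: xC; rewrite -[x](addF2K (const_mx 1)) memvD.
  by apply/negbTE; apply: contra xC => /E_sub.
have [xE|xE] := boolP (x \in E).
  by rewrite addr_const1 // xE mulr1 mulr0 addr0 -[in LHS](add0r x) vE.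
have x1E : x + const_mx 1 \in E by rewrite addr_const1.
by rewrite x1E mulr0 add0r mulr1 -(vE _ x1E (const_mx 1)) addrCA F2mx_addxx addr0.
Qed.

Let Q := css_space C C1 C2.

Lemma mem_css_space v : v \in Q <-> (forall s, S s -> s *m v = v).
Proof.
have memQ a : a \in C1 -> css_ket C C2 a \in Q.
  by move=> aC; apply/memv_span/image_f.
split=> [|/fixed_css_ket ->]; last by rewrite memvD // memvZ // memQ // mem0v.
move=> vQ s Ss; move: v vQ.
(* The vectors fixed by [s] form a kernel, so it is enough to test the spanning vectors. *)
have : (Q <= lker (linfun (mulmx s) - \1%VF)%R)%VS.
  apply/span_subvP => _ /imageP[a aC ->].
  by rewrite memv_ker !lfun_simp /= css_ket_fixed // subrr.
by move=> /subvP h v /h; rewrite memv_ker !lfun_simp subr_eq0 => /eqP.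
Qed.

Lemma css_basis : basis_of Q [:: k0; k1].
Proof.
have memQ a : a \in C1 -> css_ket C C2 a \in Q.
  by move=> aC; apply/memv_span/image_f.
have E0 : 0 \in E by rewrite mem0v.
have E1 : const_mx 1 \notin E by rewrite -[const_mx 1]add0r addr_const1 ?mem0v ?negbK.
rewrite /basis_of eqEsubv -andbA; apply/and3P; split.
- by apply/span_subvP => v; rewrite !inE => /orP[] /eqP ->; rewrite memQ ?mem0v.
- apply/subvP => v /mem_css_space/fixed_css_ket ->.
  by rewrite memvD // memvZ // memv_span // !inE eqxx ?orbT.
(* The two states live on disjoint cosets: [k1] is nonzero at the all-ones word, and at 0 it
   vanishes while [k0] does not. *)
rewrite free_cons seq1_free span_seq1; apply/andP; split; last first.
  apply/eqP => /(congr1 (fun v => amp v (const_mx 1))).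
  rewrite amp_css_ket F2mx_addxx E0 mulr1 /amp mxE => /eqP.
  by rewrite (negPf N_neq0).
apply/vlineP => -[c] /(congr1 (fun v => amp v 0)).
rewrite (ampZ c) !amp_css_ket !add0r E0 (negPf E1) mulr1 !mulr0 => /eqP.
by rewrite (negPf N_neq0).
Qed.

Lemma dim_css_space : \dim Q = 2.
Proof. by rewrite -(span_basis css_basis); apply/eqP; have := basis_free css_basis. Qed.

Lemma nontrivial_css_logicalP P : nontrivial_logical S P <->
  [/\ xpart P \in C1, zpart P \in dual_code E &
      ~~ ((xpart P \in E) && (zpart P \in dual_code C1))].
Proof.
have ph0 x : phase P * sgn (zpart P) x != 0.
  by rewrite -normr_eq0 normrM norm_phase norm_sgn mulr1 oner_eq0.
have p0 : phase P != 0 by rewrite -normr_eq0 norm_phase oner_eq0.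
rewrite /nontrivial_logical pauli_opE; split=> [[comm nS] | [xC zE nE]].
  split.
  - rewrite -(dual_codeK C1); apply/mem_dualP => c cC.
    have Sc : S (monomx 0 (sgn c)) by apply/css_stabilizerP; exists 0, c; rewrite mem0v.
    (* Comparing the phases of the two products at 0 isolates the sign of [c] at [xpart P]. *)
    have := comm _ Sc; rewrite !monomx_mul => /monomx_inj[|_ /(_ 0)].
      by move=> x; rewrite mulf_neq0 // sgn_neq0.
    by rewrite !addr0 add0r !sgn0 mulr1 mul1r -{2}[phase P]mulr1 => /(mulfI p0); rewrite sgnC.
  - apply/mem_dualP => a aE.
    have Sa : S (monomx a (sgn 0)) by apply/css_stabilizerP; exists a, 0; rewrite mem0v.
    have := comm _ Sa; rewrite !monomx_mul => /monomx_inj[|_ /(_ 0)].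
      by move=> x; rewrite mulf_neq0 // sgn_neq0.
    by rewrite !add0r !sgn0l sgn0 !mulr1 mul1r -{1}[phase P]mulr1 => /(mulfI p0).
  apply/negP => /andP[xE zC]; apply: nS; exists (phase P)^-1.
  rewrite normfV norm_phase invr1; split=> //; apply/css_stabilizerP.
  exists (xpart P), (zpart P); split=> //; rewrite monomx_scale.
  by apply: eq_monomx => // x; rewrite mulKf.
split=> [s /css_stabilizerP[a [b [aE bC ->]]] | [c [c1]]].
  rewrite !monomx_mul; apply: eq_monomx => [|x]; first exact: addrC.
  rewrite !sgnD; have /mem_dualP/(_ _ xC) -> := bC; have /mem_dualP/(_ _ aE) -> := zE.
  by rewrite !mulr1 mulrC.
case/css_stabilizerP => a [b [aE bC]]; rewrite monomx_scale.
case/monomx_inj => [x|xa e]; first by rewrite mulf_neq0 // -normr_eq0 c1 oner_eq0.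
(* Stabilizer elements have phase 1 at 0, so the scalar [c] cancels [phase P] exactly. *)
have cp : c * phase P = 1 by have := e 0; rewrite !sgn0 mulr1.
case/negP: nE; rewrite xa aE /= (_ : zpart P = b) //.
by apply: sgn_inj => x; rewrite -e mulrA cp mul1r.
Qed.

(** A nontrivial logical operator has an X-part or a Z-part of odd weight, and weighs at least as
    much as either part. Pure X or pure Z operators attain the bound. *)
Lemma css_stabilizer_code d :
  (forall a, a \in C1 -> odd (hweight a) -> (d <= hweight a)%N) ->
  (forall b, b \in dual_code E -> odd (hweight b) -> (d <= hweight b)%N) ->
  (exists2 a, a \in C1 & odd (hweight a) /\ hweight a = d) \/
  (exists2 b, b \in dual_code E & odd (hweight b) /\ hweight b = d) ->
  stabilizer_code Q S 1 d.
Proof.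
move=> minX minZ att; split; [exact: mem_css_space | exact: dim_css_space | |].
  case: att => [[a aC [oa <-]] | [b bE [ob <-]]].
    exists (pauli_of a 0).
      apply/nontrivial_css_logicalP; rewrite xpart_of zpart_of !mem0v aC.
      by rewrite mem_even_code oa andbF.
    by rewrite pauli_weightE xpart_of zpart_of; apply: eq_card => k; rewrite !inE mxE eqxx orbF.
  exists (pauli_of 0 b).
    apply/nontrivial_css_logicalP; rewrite xpart_of zpart_of !mem0v bE.
    by rewrite mem_dual_odd // ob.
  by rewrite pauli_weightE xpart_of zpart_of; apply: eq_card => k; rewrite !inE mxE eqxx.
move=> P /nontrivial_css_logicalP[xC zE]; rewrite negb_and => /orP nE.
have wX : (hweight (xpart P) <= pauli_weight P)%N.
  by rewrite pauli_weightE; apply/subset_leq_card/subsetP => k; rewrite !inE => ->.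
have wZ : (hweight (zpart P) <= pauli_weight P)%N.
  by rewrite pauli_weightE; apply/subset_leq_card/subsetP => k; rewrite !inE orbC => ->.
case: nE => [xE | zC].
  by apply: leq_trans wX; apply: minX => //; move: xE; rewrite mem_even_code xC negbK.
by apply: leq_trans wZ; apply: minZ => //; move: zC; rewrite mem_dual_odd // negbK.
Qed.

(** * The transversal phase gate on the code space *)

Section PhaseGate.
Variables (D : nat) (w : C).
Hypotheses (D_gt0 : (0 < D)%N) (wD : w ^+ D = 1).
Hypothesis even_weight : forall a, a \in C1 -> ~~ odd (hweight a) -> (D %| hweight a)%N.
Hypothesis odd_weight : forall a, a \in C1 -> odd (hweight a) -> (D %| (hweight a).+1)%N.

Let w_neq0 : w != 0.
Proof. by apply: contra_eq_neq wD => ->; rewrite expr0n gtn_eqF // eq_sym oner_eq0. Qed.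

Let norm_w : `|w| = 1.
Proof. by apply/eqP; rewrite -(pexpr_eq1 D_gt0) // -normrX wD normr1. Qed.

Let G : 'M[C]_(2 ^ n) := tens (fun _ : 'I_n => mx2 1 0 0 w).

Lemma phase_gate_css_ket0 : G *m k0 = k0.
Proof.
apply: amp_inj => x; rewrite /G tens_phase_gate amp_monomx !addr0 amp_css_ket addr0.
case: (boolP (x \in E)) => [xE|]; last by rewrite !mulr0.
have : (D %| hweight x)%N.
  by move: xE; rewrite mem_even_code => /andP[xC]; apply: even_weight.
by case/dvdnP => q ->; rewrite mulnC exprM wD expr1n mul1r.
Qed.

(** The state [k1] is supported on odd words of [C1], whose weights are -1 modulo [D]; this is where
    the inverse in the encoded gate comes from. *)
Lemma phase_gate_css_ket1 : G *m k1 = w^-1 *: k1.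
Proof.
apply: amp_inj => x; rewrite /G tens_phase_gate (ampZ w^-1) amp_monomx !addr0 amp_css_ket.
case: (boolP (_ \in E)) => [x1E|]; last by rewrite !mulr0.
have xC : x \in C1 by rewrite -[x](addF2K (const_mx 1)) memvD // E_sub.
have : (D %| (hweight x).+1)%N.
  apply: odd_weight => //; move: x1E.
  by rewrite addr_const1 // mem_even_code xC negbK.
case/dvdnP => q e; congr (_ * _); apply: (mulIf w_neq0).
by rewrite mulVf // -exprSr e mulnC exprM wD expr1n.
Qed.

Lemma phase_gate_enacts : enacts Q k0 k1 G (mx2 1 0 0 w^-1).
Proof.
split; first exact: css_basis.
  by rewrite !mxE /= scale1r scale0r addr0 phase_gate_css_ket0.
by rewrite !mxE /= scale0r add0r phase_gate_css_ket1.
Qed.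

Lemma phase_gate_transversal : transversal_gate Q G.
Proof.
split.
  exists (fun=> mx2 1 0 0 w); split=> // _; apply/unitarymxP/matrixP => i j.
  rewrite mxE !big_ord_recl big_ord0 !mxE.
  case: i => -[|[|i]] // hi; case: j => -[|[|j]] // hj; rewrite /=
    ?mul0r ?conjC0 ?mulr0 ?add0r ?addr0 ?mul1r ?conjC1 //.
  by rewrite -normCK norm_w expr1n.
move=> v; rewrite -(span_basis css_basis) span_cons span_seq1 => /memv_addP.
case=> u /vlineP[c ->] [u' /vlineP[c' ->] ->].
rewrite mulmxDr -(scalemxAr c) -(scalemxAr c') phase_gate_css_ket0 phase_gate_css_ket1.
apply: memv_add; apply: memvZ; first exact: memv_line.
exact/memvZ/memv_line.
Qed.

End PhaseGate.

End CSS.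

(** * One-qubit monomial gates in the Clifford hierarchy *)

Lemma sqr_sgn n (b x : 'rV['F_2]_n) : sgn b x ^+ 2 = 1.
Proof. by rewrite /sgn /chi sqrr_sign. Qed.

(** The phases allowed in the Pauli group are the fourth roots of unity, a condition that passes to
    products. *)
Lemma unit_quartic (c : C) : (c \in [:: 1; -1; 'i; - 'i]) = (c ^+ 4 == 1).
Proof.
have -> : c ^+ 4 = (c ^+ 2) ^+ 2 by rewrite -exprM.
rewrite sqrf_eq1 sqrf_eq1 -sqrCi eqf_sqr !inE; by rewrite -!orbA.
Qed.

Lemma phase4 n (P : 'I_n -> pauli) : phase P ^+ 4 = 1.
Proof.
rewrite /phase -prodrXl big1 // => k _.
by apply/eqP; rewrite -unit_quartic !inE /pauli_phase; case: (P k); rewrite eqxx ?orbT.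
Qed.

Lemma rV1_cases (x : 'rV['F_2]_1) : x = 0 \/ x = const_mx 1.
Proof.
have [h|h] := eqVneq (x 0 0) 0; [left|right]; apply/rowP => i.
  by rewrite !ord1 h mxE.
by rewrite !ord1 (F2E (x _ _)) h mxE.
Qed.

Lemma conj_unit (z : C) : `|z| = 1 -> z^* = z^-1.
Proof.
move=> z1; have z0 : z != 0 by rewrite -normr_eq0 z1 oner_eq0.
by apply: (mulfI z0); rewrite mulfV // -normCK z1 expr1n.
Qed.

(** Conjugating a Pauli operator by such a gate gives a gate of the same form whose ratio of phases
    is, up to sign, 1 or the square of the old one; so each level halves the order required. The
    condition on [f 0] concerns level 1, where the phase must be a power of i. *)
Lemma hierarchy_monomx k a (f : 'rV['F_2]_1 -> C) : (forall x, `|f x| = 1) ->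
  (f (const_mx 1) / f 0) ^+ (2 ^ k.+1) = 1 -> (k = 0%N -> f 0 ^+ 4 = 1) ->
  hierarchy k.+1 (monomx a f).
Proof.
elim: k a f => [|k IHk] a f f1 fr f4.
  (* The ratio squares to 1: it is 1 without a Z factor and -1 with one. *)
  rewrite /=; set b : 'rV['F_2]_1 := if f (const_mx 1) / f 0 == 1 then 0 else const_mx 1.
  have f0 : f 0 != 0 by rewrite -normr_eq0 f1 oner_eq0.
  have fE x : f x = f 0 * sgn b x.
    have [->|->] := rV1_cases x; first by rewrite sgn0 mulr1.
    rewrite -[LHS](divfK f0) mulrC; congr (_ * _); move: fr => /eqP.
    rewrite sqrf_eq1 /b; case: eqP => [-> _|_ /= /eqP ->]; first by rewrite sgn0l.
    by rewrite /sgn row_dotE big_ord1 !mxE mulr1.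
  set P := pauli_of a b.
  have p0 : phase P != 0 by rewrite -normr_eq0 norm_phase oner_eq0.
  exists (f 0 / phase P), P; split.
    by rewrite unit_quartic expr_div_n f4 // phase4 divr1.
  rewrite pauli_opE monomx_scale xpart_of zpart_of; apply: eq_monomx => // x.
  by rewrite mulrA divfK.
split; first exact: monomx_unitary.
move=> _ [c [P [hc ->]]]; rewrite unit_quartic in hc.
have c1 : `|c| = 1.
  by apply/eqP; rewrite -(@pexpr_eq1 _ _ 4) // -normrX (eqP hc) normr1.
have c0 : c != 0 by rewrite -normr_eq0 c1 oner_eq0.
have p0 : phase P != 0 by rewrite -normr_eq0 norm_phase oner_eq0.
have fn0 x : f x != 0 by rewrite -normr_eq0 f1 oner_eq0.
set o : 'rV['F_2]_1 := const_mx 1 in fr *.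
rewrite pauli_opE monomx_scale monomx_adj !monomx_mul.
rewrite (@eq_monomx _ _ _ _
  (fun x => c * phase P * (f x / f (x + xpart P)) * sgn (zpart P) (x + a)) erefl); last first.
  move=> x; rewrite (_ : x + (a + xpart P) + a = x + xpart P); last first.
    by rewrite addrA [x + a + _]addrAC addF2K.
  rewrite conj_unit //; field; exact: fn0.
set s := sgn (zpart P).
apply: IHk => [x|| k0].
- by rewrite !normrM normfV !f1 c1 norm_phase norm_sgn invr1 !mulr1.
- rewrite -/o !add0r.
  have -> : c * phase P * (f o / f (o + xpart P)) * s (o + a) /
      (c * phase P * (f 0 / f (xpart P)) * s a) =
      (f o / f (o + xpart P)) / (f 0 / f (xpart P)) * s o.
    by rewrite [o + a]addrC /s sgnD; field; rewrite !fn0 sgn_neq0 p0 c0.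
  (* Without an X-part the ratios of [f] cancel; with one they combine to a square. The remaining
     sign dies in the even power. *)
  have [->|->] := rV1_cases (xpart P).
    by rewrite addr0 !divff ?oner_eq0 // mul1r expnS exprM sqr_sgn expr1n.
  rewrite F2mx_addxx -[f 0 / f o]invf_div invrK -expr2 exprMn -exprM -expnS fr mul1r.
  by rewrite expnS exprM sqr_sgn expr1n.
rewrite !exprMn (eqP hc) phase4 !mul1r (_ : s _ ^+ 4 = 1); last first.
  by rewrite (_ : 4 = 2 * 2)%N // exprM sqr_sgn expr1n.
rewrite mulr1 add0r -exprMn; have [->|->] := rV1_cases (xpart P); first by rewrite divff // expr1n.
by rewrite -[f 0 / _]invf_div exprVn; move: fr; rewrite k0 => ->; rewrite invr1.
Qed.

End Monomial.

(** * Complex exponentials and the quantum Reed-Muller codes *)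

Lemma cexpiX (R : realType) (t : R) k : cexpi t ^+ k = cexpi (t *+ k).
Proof.
elim: k => [|k IHk]; first by rewrite mulr0n /cexpi cos0 sin0.
rewrite exprSr IHk mulrSr /cexpi cosD sinD; apply/eqP; rewrite eq_complex /=.
by rewrite eqxx [X in _ == X]addrC eqxx.
Qed.

Lemma cexpiN (R : realType) (t : R) : cexpi (- t) = (cexpi t)^-1.
Proof.
have e : cexpi t * cexpi (- t) = 1.
  apply/eqP; rewrite eq_complex /= cosN sinN; apply/andP; split; apply/eqP.
    by rewrite mulrN opprK -!expr2 cos2Dsin2.
  by rewrite mulrN addrC mulrC subrr.
have t0 : cexpi t != 0 by apply: contra_eq_neq e => ->; rewrite mul0r eq_sym oner_eq0.
by apply: (mulfI t0); rewrite e mulfV.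
Qed.

Theorem corollary4 (R : realType) (m r : nat) (p : 'I_(2 ^ m))
    (C2 : code (2 ^ m).-1) :
  (0 < r)%N -> (r <= m %/ 2)%N ->
  let n := (2 ^ m).-1 in
  let C1 : code n := puncturedRM r p in
  let Delta := (2 ^ (m %/ r - 1))%N in
  let theta : R := 2 * pi / Delta%:R in
  let Q : {vspace 'cV[R[i]]_(2 ^ n)} := css_space R[i] C1 C2 in
  let G : 'M[R[i]]_(2 ^ n) := tens (fun _ : 'I_n => phase_gate theta) in
  let Gbar : 'M[R[i]]_2 := phase_gate (- theta) in
  dual_code C2 = even_code C1 ->
  [/\ stabilizer_code Q (@css_stabilizer R[i] n C1 C2) 1
        (minn (2 ^ (m - r) - 1) (2 ^ r.+1 - 1)),
      transversal_gate Q G,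
      enacts Q (css_ket R[i] C2 0) (css_ket R[i] C2 (const_mx 1)) G Gbar
    & hierarchy_mod_phase (trunc_log 2 Delta) (tens (fun _ : 'I_1 => Gbar))].
Proof.
move=> r0 rm n C1 Delta theta Q G Gbar dC2.
have c1 : const_mx 1 \in C1 by exact: const1_puncturedRM.
have on : odd (hweight (const_mx 1 : 'rV['F_2]_n)) by exact: odd_hweight_const1 rm.
have D0 : (0 < Delta)%N by rewrite expn_gt0.
have wD : cexpi theta ^+ Delta = 1.
  rewrite cexpiX /theta -[_ *+ Delta]mulr_natr divfK ?pnatr_eq0 ?gtn_eqF //.
  by rewrite /cexpi mulr_natl cos2pi sin2pi.
have even_wt := puncturedRM_even_weight r0 rm (p := p).
have odd_wt := puncturedRM_odd_weight r0 rm (p := p).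
split.
- apply: css_stabilizer_code => // [a aC oa | b bE ob |].
  + by rewrite geq_min (puncturedRM_odd_min (p := p)).
  + by rewrite geq_min (dual_even_min (p := p)) ?orbT.
  (* An X-type operator attains 2^(m-r) - 1 and a Z-type one attains 2^(r+1) - 1. *)
  + rewrite /minn; case: ifP => _.
      by left; apply: puncturedRM_odd_min_attained.
    by right; apply: dual_even_min_attained.
- exact: phase_gate_transversal even_wt odd_wt.
- rewrite /Gbar /phase_gate cexpiN; exact: phase_gate_enacts even_wt odd_wt.
exists 1; split; first exact: normr1.
have K1 : (1 < m %/ r)%N.
  by rewrite leq_divRL // mulnC -leq_divRL.
rewrite scale1r /Gbar /phase_gate cexpiN tens_phase_gate trunc_expnK //.
have nw : `|cexpi theta| = 1.
  by apply/eqP; rewrite -(pexpr_eq1 D0) // -normrX wD normr1.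
have h0 : hweight (0 : 'rV['F_2]_1) = 0%N by rewrite hweightE big_ord1 mxE eqxx.
have h1 : hweight (const_mx 1 : 'rV['F_2]_1) = 1%N by rewrite hweightE big_ord1 mxE.
(* The level, log_2 of [Delta], is [m %/ r - 1]; it is positive, hence a successor as
   [hierarchy_monomx] requires. *)
rewrite -(prednK (_ : 0 < m %/ r - 1)%N) ?subn_gt0 //; apply: hierarchy_monomx => [x||_].
- by rewrite normrX normfV nw invr1 expr1n.
- by rewrite h0 h1 expr0 divr1 expr1 prednK ?subn_gt0 // exprVn wD invr1.
by rewrite h0 expr0 expr1n.
Qed.
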